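(* Let $m$ be a positive integer with $m\ne 2$, let $p$ be an odd prime, and let $n=mp$. Then the complement of the cycle $C_n$ does not exhibit pretty good state transfer.
   Context: For a finite simple graph $G$ with adjacency matrix $A$, the transition matrix is $H(t)=\exp(-itA)$, $t\in\mathbb{R}$. For a vertex $u$, $e_u$ denotes the standard basis (column) vector indexed by $u$. The graph $G$ exhibits pretty good state transfer between two distinct vertices $u$ and $v$ if there exist a sequence of real numbers $\{t_k\}$ and a complex number $\gamma$ with $|\gamma|=1$ such that $\lim_{k\to\infty}H(t_k)e_u=\gamma e_v$. The graph $G$ exhibits pretty good state transfer if it does so between some pair of distinct vertices. The cycle $C_n$ ($n\ge 3$) is the graph with vertex set $\mathbb{Z}_n$ in which $a,b$ are adjacent if and only if $a-b\in\{1,n-1\}$. *)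

(* Defs.v *)
From HB Require Import structures.
From mathcomp Require Import all_boot all_order all_algebra.
From mathcomp Require Export complex.
From mathcomp Require Import all_classical all_reals all_analysis.
Set Implicit Arguments.
Unset Strict Implicit.
Unset Printing Implicit Defensive.
Import Order.TTheory GRing.Theory Num.Theory numFieldNormedType.Exports.
Local Open Scope classical_set_scope.
Local Open Scope ring_scope.
Local Open Scope complex_scope.

(* R[i] does not directly inherit the norm topology of numFieldType structures;
   going through this packed structure gives limits in 'M[Cplx R]_(m, n). *)
Definition Cplx (R : realType) : numClosedFieldType := R[i].

Definition expmx (R : realType) (n : nat) (M : 'M[Cplx R]_n) : 'M[Cplx R]_n :=
  lim (series (fun k : nat => (k`!%:R)^-1 *: M ^+ k) @ \oo).

Record sgraph (V : finType) := SGraph {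
  adj :> rel V;
  adj_sym : symmetric adj;
  adj_irr : irreflexive adj }.

Definition compl_rel (V : finType) (G : sgraph V) : rel V :=
  fun x y => (x != y) && ~~ G x y.

Fact compl_sym (V : finType) (G : sgraph V) : symmetric (compl_rel G).
Proof. by move=> x y; rewrite /compl_rel eq_sym adj_sym. Qed.

Fact compl_irr (V : finType) (G : sgraph V) : irreflexive (compl_rel G).
Proof. by move=> x; rewrite /compl_rel eqxx. Qed.

Definition compl_graph (V : finType) (G : sgraph V) : sgraph V :=
  SGraph (@compl_sym V G) (@compl_irr V G).

(* In 'Z_n the residue n - 1 is - 1. This is the cycle C_n only for n >= 3
   ('Z_0 and 'Z_1 are both the ring of integers mod 2). *)
Definition cycle_rel (n : nat) : rel 'Z_n :=
  fun a b => (a - b == 1) || (a - b == - 1).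

Fact cycle_sym (n : nat) : symmetric (@cycle_rel n).
Proof.
by move=> a b; rewrite /cycle_rel -(opprB b a) eqr_opp eqr_oppLR orbC.
Qed.

Fact cycle_irr (n : nat) : irreflexive (@cycle_rel n).
Proof.
by move=> a; rewrite /cycle_rel subrr eq_sym oner_eq0 eq_sym oppr_eq0 oner_eq0.
Qed.

Definition cycle_graph (n : nat) : sgraph 'Z_n :=
  SGraph (@cycle_sym n) (@cycle_irr n).

Definition adjmx (R : realType) (V : finType) (G : sgraph V) :
    'M[Cplx R]_#|V| :=
  \matrix_(i, j) (G (enum_val i) (enum_val j))%:R.

Definition transmx (R : realType) (V : finType) (G : sgraph V) (t : R) :
    'M[Cplx R]_#|V| :=
  expmx ((- ('i * t%:C) : Cplx R) *: adjmx R G).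

Definition basis_vec (R : realType) (V : finType) (u : V) : 'cV[Cplx R]_#|V| :=
  delta_mx (enum_rank u) 0.

Definition pgst_between (R : realType) (V : finType) (G : sgraph V) (u v : V) :=
  exists (t : nat -> R) (gamma : Cplx R), `|gamma| = 1 /\
    (transmx G (t k) *m basis_vec R u @[k --> \oo] --> gamma *: basis_vec R v).

Definition pgst (R : realType) (V : finType) (G : sgraph V) :=
  exists u v : V, u != v /\ pgst_between R G u v.

(* Main.v *)
Require Import Defs.
From mathcomp Require Import all_boot all_order all_algebra.
From mathcomp Require Import all_solvable all_field.
From mathcomp Require Import all_classical all_reals all_analysis.
Set Implicit Arguments.
Unset Strict Implicit.
Unset Printing Implicit Defensive.
Import Order.TTheory GRing.Theory Num.Theory numFieldNormedType.Exports.

(* The characters x |-> z ^ x of Z_n, for z an n-th root of unity, are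
   eigenvectors of the complement of C_n, with real eigenvalue ev(z) equal to
   -1 - z - 1/z when z <> 1. If H(t_k) e_u --> gamma e_v and d = v - u, then
   exp(-i t_k ev(z)) --> gamma z ^ d for every such z. As ev(1/z) = ev(z), this
   forces w ^ (2 d) = 1 for w a primitive root, so n = 2 d, w ^ d = -1 and m is
   even, hence m >= 4. Put zeta = w ^ m, a primitive p-th root of unity with
   zeta ^ d = 1. For a = 1 and a = 2 the eigenvalues of the p roots
   w ^ a * zeta ^ k are all nontrivial and add up to -p; multiplying the
   p limits shows that exp(i t_k p) tends both to gamma ^ p (-1) ^ p (a = 1) and to
   gamma ^ p (a = 2), which is absurd as p is odd. *)

(* The section delimits the scopes: with [ring_scope] open, the literal [2] in
   the theorem would be read as [2%:R] in the semiring [nat]. *)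
Section Scopes.
Local Open Scope classical_set_scope.
Local Open Scope ring_scope.
Local Open Scope complex_scope.

(** * The exponential series at imaginary arguments *)

Definition cis (R : realType) (x : R) : Cplx R := cos x +i* sin x.

Lemma cis0 (R : realType) : cis (0 : R) = 1.
Proof. by rewrite /cis cos0 sin0. Qed.

Lemma cisD (R : realType) (x y : R) : cis (x + y) = cis x * cis y.
Proof. by rewrite /cis cosD sinD [sin x * _ + _]addrC. Qed.

Lemma cis_sum (R : realType) (I : finType) (x : I -> R) :
  cis (\sum_i x i) = \prod_i cis (x i).
Proof. by rewrite (big_morph _ (@cisD R) (cis0 R)). Qed.

Lemma cvg_real_complex (R : realType) (u : nat -> R) (l : R) :
  u k @[k --> \oo] --> l -> ((u k)%:C : Cplx R) @[k --> \oo] --> (l%:C : Cplx R).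
Proof.
move=> ul; apply/cvgrPdist_lt => e e0.
(* A positive element of [Cplx R] is real, so [e] descends to a radius in [R]. *)
have eR : e = (complex.Re e)%:C by rewrite RRe_real// gtr0_real.
have e0' : 0 < complex.Re e by move: e0; rewrite eR ltcR.
move/cvgrPdist_lt: ul => /(_ _ e0'); apply: filterS => k lt_e.
by rewrite -rmorphB eR normc_def /= expr0n addr0 sqrtr_sqr ltcR.
Qed.

Lemma exp_term_imaginary (R : realType) (x : R) (k : nat) :
  (k`!%:R)^-1 * ('i * x%:C) ^+ k = cos_coeff x k +i* sin_coeff x k :> Cplx R.
Proof.
rewrite exprMn -rmorphXn -[k`!%:R](rmorph_nat (real_complex R)) -fmorphV.
rewrite mulrCA -rmorphM /= /cos_coeff /sin_coeff /=.
(* The parity factors are those of [cos_coeff] and [sin_coeff]; the truncated [k.-1] at [k = 0] is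
   harmless, its factor [(odd k)%:R] being zero. *)
have -> : 'i ^+ k = (~~ odd k)%:R * (-1) ^+ k./2
            +i* ((odd k)%:R * (-1) ^+ k.-1./2) :> R[i].
  rewrite -[in LHS](odd_double_half k) exprD -mul2n exprM sqr_i.
  have -> : (-1) ^+ k./2 = ((-1) ^+ k./2 : R)%:C :> R[i].
    by rewrite rmorphXn rmorphN1.
  case: k => [|k] /=; first by simpc.
  by rewrite uphalf_half; case: (odd k) => /=; simpc.
by simpc; rewrite -!mulrA ![x ^+ k / _]mulrC.
Qed.

Lemma cvg_exp_imaginary (R : realType) (x : R) :
  series (fun k => (k`!%:R)^-1 * ('i * x%:C) ^+ k : Cplx R) @ \oo --> cis x.
Proof.
pose emb (y : R) : Cplx R := y%:C; pose I : Cplx R := 'i.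
have -> : series (fun k => (k`!%:R)^-1 * ('i * x%:C) ^+ k : Cplx R)
  = (fun N => emb (series (cos_coeff x) N) + I * emb (series (sin_coeff x) N)).
  apply/funext => N; rewrite /series /= /emb !(raddf_sum (real_complex R)).
  rewrite mulr_sumr -big_split /=.
  by apply: eq_bigr => k _; rewrite exp_term_imaginary [LHS]complexE.
have -> : cis x = emb (cos x) + I * emb (sin x) by rewrite [LHS]complexE.
apply: cvgD; last apply: cvgMr; apply: cvg_real_complex.
  rewrite cos.unlock; exact: is_cvg_series_cos_coeff.
rewrite sin.unlock; exact: is_cvg_series_sin_coeff.
Qed.

(** * Limits of finite products and of matrices; matrix exponentials *)

Lemma cvgr_prod (K : numFieldType) (I : finType) (f : I -> nat -> K) (l : I -> K) :
  (forall i, f i k @[k --> \oo] --> l i) ->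
  \prod_i f i k @[k --> \oo] --> \prod_i l i.
Proof.
move=> fl; apply: (@cvg_big K I *%R 1 xpredT) => [|i _]; last exact: fl.
exact: mul_continuous.
Qed.

(** A neighbourhood of a matrix contains a box of entrywise neighbourhoods, and finitely many
    eventual conditions hold eventually together. *)
Lemma cvg_mx_entries (K : numFieldType) (m n : nat) (M : nat -> 'M[K]_(m, n))
    (L : 'M[K]_(m, n)) :
  (forall i j, M k i j @[k --> \oo] --> L i j) -> M k @[k --> \oo] --> L.
Proof.
move=> ML A [P LP sPA]; apply: (filterS sPA).
have MP i : \forall k \near \oo, forall j, P i j (M k i j).
  by apply: filter_forall => j; exact: ML (LP i j).
exact: filter_forall MP.
Qed.

Lemma cvg_mulmx_entry (K : numFieldType) (m n p : nat) (P : 'M[K]_(m, n))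
    (M : nat -> 'M[K]_(n, p)) (L : 'M[K]_(n, p)) i j :
  M k @[k --> \oo] --> L ->
  (P *m M k) i j @[k --> \oo] --> (P *m L) i j.
Proof.
move=> ML; rewrite mxE.
under eq_fun do rewrite mxE.
apply: (cvg_big (op := +%R)) => [|l _]; first exact: add_continuous.
apply: cvgMr; exact: (cvg_comp _ _ ML (@coord_continuous _ _ _ l j L)).
Qed.

(** [P] conjugates each partial sum of the exponential series to a diagonal matrix of scalar partial
    sums, whose limits are known. *)
Lemma expmx_diag (R : realType) (n : nat) (A P : 'M[Cplx R]_n) (d : 'I_n -> R) :
  P \in unitmx ->
  P *m A = diag_mx (\row_j ('i * (d j)%:C : Cplx R)) *m P ->
  P *m expmx A = diag_mx (\row_j cis (d j)) *m P.
Proof.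
move=> Pu PA.
pose c j : Cplx R := 'i * (d j)%:C.
have PAk k : P *m A ^+ k = diag_mx (\row_j c j ^+ k) *m P.
  elim: k => [|k IHk].
    rewrite expr0 mulmx1 (_ : \row_j _ = const_mx 1) ?diag_const_mx ?mul1mx//.
    by apply/rowP => j; rewrite !mxE.
  rewrite exprSr mulmxA IHk -mulmxA PA mulmxA mulmx_diag; congr (diag_mx _ *m _).
  by apply/rowP => j; rewrite !mxE exprSr.
suff -> : expmx A = invmx P *m (diag_mx (\row_j cis (d j)) *m P).
  by rewrite mulKVmx.
rewrite /expmx; apply: cvg_lim; first exact: norm_hausdorff.
apply: cvg_mx_entries => i j.
have -> : (fun k => series (fun k => (k`!%:R)^-1 *: A ^+ k) k i j)
  = (fun N => \sum_l invmx P i l *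
       (series (fun k => (k`!%:R)^-1 * c l ^+ k) N * P l j)).
  apply/funext => N.
  have -> : series (fun k => (k`!%:R)^-1 *: A ^+ k) N =
    invmx P *m (diag_mx (\row_l series (fun k => (k`!%:R)^-1 * c l ^+ k) N) *m P).
    apply: (canRL (mulKmx Pu)); rewrite /series /= mulmx_sumr.
    under eq_bigr do rewrite -scalemxAr PAk scalemxAl -linearZ /=.
    rewrite -mulmx_suml -linear_sum /=; congr (diag_mx _ *m _).
    apply/rowP => l; rewrite summxE !mxE.
    by apply: eq_bigr => k _; rewrite !mxE.
  by rewrite mxE; apply: eq_bigr => l _; rewrite mul_diag_mx !mxE.
rewrite mxE; apply: (cvg_big (op := +%R)) => [|l _]; first exact: add_continuous.
rewrite mul_diag_mx !mxE; apply: cvgMr; apply: cvgMl; exact: cvg_exp_imaginary.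
Qed.

(** The rows of [P] are left eigenvectors of the adjacency matrix, so multiplying the limit by [P]
    decouples it into one scalar limit per row. *)
Lemma pgst_between_diag (R : realType) (V : finType) (G : sgraph V) (u v : V)
    (P : 'M[Cplx R]_#|V|) (d : 'I_#|V| -> R) :
  P \in unitmx ->
  P *m adjmx R G = diag_mx (\row_j ((d j)%:C : Cplx R)) *m P ->
  pgst_between R G u v ->
  exists (t : nat -> R) (gamma : Cplx R), `|gamma| = 1 /\
    forall j, cis (- (t k * d j)) * P j (enum_rank u) @[k --> \oo] -->
      gamma * P j (enum_rank v).
Proof.
move=> Pu PA [t [gamma [gamma1 Hcvg]]]; exists t, gamma; split=> // j.
have := @cvg_mulmx_entry _ _ _ _ P _ _ j 0 Hcvg.
rewrite -scalemxAr mxE /basis_vec -colE mxE.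
apply: cvg_trans; apply: near_eq_cvg; near=> k.
have E : P *m transmx G (t k) =
    diag_mx (\row_l cis (- (t k * d l))) *m P.
  apply: expmx_diag Pu _.
  rewrite -scalemxAr PA scalemxAl -linearZ /=; congr (diag_mx _ *m _).
  by apply/rowP => l; rewrite !mxE rmorphN rmorphM /= mulrN mulNr mulrA.
by rewrite mulmxA E -colE mxE mul_diag_mx !mxE.
Unshelve. all: by end_near.
Qed.

(** * Roots of unity and the spectrum of the complement of the cycle *)

Lemma exists_prim_root (C : numClosedFieldType) (n : nat) :
  (0 < n)%N -> exists z : C, n.-primitive_root z.
Proof.
move=> n0; have [r] := closed_field_poly_normal ('X^n - 1 : {poly C}).
rewrite (monicP _) ?monicXnsubC// scale1r => XnE.
have /hasP[z _ zP] : has n.-primitive_root r; last by exists z.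
(* At least [n] distinct [n]-th roots of unity include a primitive one; distinctness is separability
   of [X^n - 1] in characteristic zero. *)
apply: has_prim_root => //.
- by apply/allP => z; rewrite -root_prod_XsubC -XnE.
- by rewrite -separable_prod_XsubC -XnE separable_Xn_sub_1// pnatr_eq0 -lt0n.
- by rewrite -ltnS -(size_prod_XsubC r id) -XnE size_XnsubC.
Qed.

Lemma prim_root_neq0 (F : fieldType) (n : nat) (w : F) :
  n.-primitive_root w -> w != 0.
Proof.
move=> w_prim; apply: contra_eq_neq (prim_expr_order w_prim) => ->.
by rewrite expr0n gtn_eqF ?(prim_order_gt0 w_prim)// eq_sym oner_neq0.
Qed.

Lemma sum_expr_root1 (F : fieldType) (n : nat) (z : F) :
  z ^+ n = 1 -> z != 1 -> \sum_(i < n) z ^+ i = 0.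
Proof.
move=> zn1 z1; have := subrX1 z n; rewrite zn1 subrr => /esym/eqP.
by rewrite mulf_eq0 subr_eq0 (negPf z1) => /eqP.
Qed.

Section CycleSpectrum.
Variables (F : fieldType) (n : nat).
Hypothesis n_gt2 : (2 < n)%N.
Implicit Types (z : F) (x y : 'Z_n).

Let n_gt1 : (1 < n)%N. Proof. exact: ltnW. Qed.

Lemma expr_Zp0 z : z ^+ (0%R : 'Z_n) = 1.
Proof. by []. Qed.

Lemma expr_Zp1 z : z ^+ (1%R : 'Z_n) = z.
Proof. by rewrite /= Zp_cast// modn_small// expr1. Qed.

(** Addition in ['Z_n] reduces modulo [n], which [z ^+ n = 1] absorbs. *)
Lemma expr_ZpD z x y : z ^+ n = 1 -> z ^+ (x + y)%R = z ^+ x * z ^+ y.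
Proof.
rewrite -{1}(Zp_cast n_gt1) => zn1.
exact: etrans (expr_mod _ zn1) (exprD _ _ _).
Qed.

Lemma expr_ZpN z x : z ^+ n = 1 -> z ^+ (- x)%R = (z ^+ x)^-1.
Proof.
move=> zn1; have := expr_ZpD (- x) x zn1; rewrite addNr expr_Zp0 => zx1.
by apply/divr1_eq; rewrite invrK -zx1.
Qed.

Lemma sum_Zp_expr z : z ^+ n = 1 -> z != 1 -> \sum_(x : 'Z_n) z ^+ x = 0.
Proof.
move=> zn1 z1; apply: sum_expr_root1 => //.
by rewrite -[(_).+2]/((Zp_trunc n).+2) Zp_cast.
Qed.

(** The complement has adjacency matrix [J - I - A], with [J] all ones and [A] that of the cycle.
    The eigenvalue of [J] is left as a character sum, so that [z = 1] is covered too. *)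
Definition compl_cycle_eigenvalue z : F :=
  \sum_(x : 'Z_n) z ^+ x - 1 - z - z^-1.

(** Translation by [x] turns the neighbourhood of [x] into the fixed set of residues other than [0],
    [1] and [-1]. *)
Lemma compl_cycle_eigenvector z x : z ^+ n = 1 ->
  \sum_(y : 'Z_n) z ^+ y * (compl_graph (cycle_graph n) y x)%:R =
  compl_cycle_eigenvalue z * z ^+ x.
Proof.
move=> zn1; rewrite (reindex_inj (addIr x)).
have adjE y : compl_graph (cycle_graph n) (y + x) x =
    [&& y != 0, y != 1 & y != -1] :> bool.
  rewrite /= /compl_rel /= /cycle_rel addrK negb_or.
  by rewrite -subr_eq0 addrK.
have one_neq0 : (1 : 'Z_n) != 0 by exact: oner_neq0.
have N1_neq0 : (-1 : 'Z_n) != 0 by rewrite oppr_eq0.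
(* Here [n > 2] matters: the three terms split off below are distinct. *)
have N1_neq1 : (-1 : 'Z_n) != 1.
  rewrite eq_sym -subr_eq0 opprK -val_eqE /= Zp_cast//.
  by rewrite !modn_small ?addn1 ?modn_small.
under eq_bigr do rewrite expr_ZpD// adjE mulrAC.
rewrite -mulr_suml /compl_cycle_eigenvalue; congr (_ * _).
have -> : \sum_(y : 'Z_n) z ^+ y =
    1 + (z + (z^-1 + \sum_(y : 'Z_n | [&& y != 0, y != 1 & y != -1]) z ^+ y)).
  rewrite (bigD1 0)// (bigD1 1)// (bigD1 (-1)) ?N1_neq0//.
  rewrite (expr_ZpN _ zn1) expr_Zp0 expr_Zp1.
  by under eq_bigl do rewrite andTb -andbA.
rewrite [1 + _]addrC addrK [z + _]addrC addrK [z^-1 + _]addrC addrK.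
rewrite [RHS]big_mkcond; apply: eq_bigr => y _.
by case: ifP; rewrite ?mulr1 ?mulr0.
Qed.

Variable w : F.
Hypothesis w_prim : n.-primitive_root w.

Definition dft_mx : 'M[F]_#|'Z_n| :=
  \matrix_(j, i) w ^+ ((enum_val j : 'Z_n) * (enum_val i : 'Z_n)).

(** Orthogonality of characters; [Q] is the scaled conjugate transpose, with inverses in place of
    conjugates over a general field. *)
Lemma dft_mx_unit : (n%:R != 0 :> F) -> dft_mx \in unitmx.
Proof.
move=> n0; pose Q : 'M[F]_#|'Z_n| :=
  n%:R^-1 *: \matrix_(i, j) (w ^+ ((enum_val j : 'Z_n) * (enum_val i : 'Z_n)))^-1.
suff /mulmx1_unit[] : dft_mx *m Q = 1%:M by [].
apply/matrixP => j l; rewrite -scalemxAr !mxE.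
pose z := w ^+ (enum_val j : 'Z_n) / w ^+ (enum_val l : 'Z_n).
transitivity (n%:R^-1 * \sum_(x : 'Z_n) z ^+ x).
  congr (_ * _); rewrite [RHS](reindex _ (onW_bij _ (@enum_val_bij _))) /=.
  by apply: eq_bigr => i _; rewrite !mxE !exprM -exprVn -exprMn.
have wn1 := prim_expr_order w_prim.
have w0 := prim_root_neq0 w_prim.
have [jl|jl] := eqVneq j l.
  rewrite /z jl divff ?expf_neq0//.
  under eq_bigr do rewrite expr1n.
  by rewrite sumr_const card_ord Zp_cast// mulVf.
rewrite sum_Zp_expr ?mulr0//.
  by rewrite /z exprMn exprVn -!exprM !(mulnC _ n) !exprM wn1 !expr1n divr1.
apply: contra jl => /eqP/divr1_eq/eqP; rewrite (eq_prim_root_expr w_prim).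
have ltZ (x : 'Z_n) : (x < n)%N by rewrite -[ltnRHS](Zp_cast n_gt1).
by rewrite !modn_small ?ltZ// => /eqP/val_inj/enum_val_inj->.
Qed.

End CycleSpectrum.

(** Inversion swaps the last two terms and permutes the character sum by [x |-> - x]. *)
Lemma compl_cycle_eigenvalueV (F : fieldType) (n : nat) (z : F) :
  (2 < n)%N -> z ^+ n = 1 ->
  compl_cycle_eigenvalue n z^-1 = compl_cycle_eigenvalue n z.
Proof.
move=> n_gt2 zn1; rewrite /compl_cycle_eigenvalue invrK addrAC.
rewrite [in RHS](reindex_inj oppr_inj); congr (_ - 1 - _ - _).
by apply: eq_bigr => x _; rewrite expr_ZpN// exprVn.
Qed.

(** On the unit circle conjugation is inversion, which fixes the eigenvalue. *)
Lemma compl_cycle_eigenvalue_real (C : numClosedFieldType) (n : nat) (z : C) :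
  (2 < n)%N -> z ^+ n = 1 -> compl_cycle_eigenvalue n z \is Num.real.
Proof.
move=> n_gt2 zn1.
have z1 : `|z| = 1.
  apply/eqP; rewrite -(@pexpr_eq1 _ _ n)// ?(ltn_trans _ n_gt2)//.
  by rewrite -normrX zn1 normr1.
have zV : (z^* )%R = z^-1 by rewrite invC_norm z1 expr1n invr1 mul1r.
apply/CrealP; rewrite -[RHS]compl_cycle_eigenvalueV// /compl_cycle_eigenvalue.
rewrite !rmorphB rmorph1 rmorph_sum fmorphV /= zV; congr (_ - 1 - _ - _).
by apply: eq_bigr => x _; rewrite rmorphXn /= zV.
Qed.

(** * Scalar consequences of pretty good state transfer *)

Lemma pgst_compl_cycle (R : realType) (n : nat) (u v : 'Z_n) : (2 < n)%N ->
  pgst_between R (compl_graph (cycle_graph n)) u v ->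
  exists (t : nat -> R) (gamma : Cplx R), `|gamma| = 1 /\
    forall z : Cplx R, z ^+ n = 1 ->
      cis (- (t k * complex.Re (compl_cycle_eigenvalue n z))) @[k --> \oo] -->
        gamma * z ^+ (v - u)%R.
Proof.
move=> n_gt2; have n_gt0 : (0 < n)%N by exact: ltn_trans n_gt2.
have [w w_prim] := @exists_prim_root (Cplx R) n n_gt0.
have wn1 := prim_expr_order w_prim.
have wXn1 k : (w ^+ k) ^+ n = 1 by rewrite -exprM mulnC exprM wn1 expr1n.
pose ev (z : Cplx R) := complex.Re (compl_cycle_eigenvalue n z).
pose P := dft_mx n w; pose d (j : 'I_#|'Z_n|) := ev (w ^+ (enum_val j : 'Z_n)).
have Pu : P \in unitmx by rewrite dft_mx_unit// pnatr_eq0 -lt0n.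
have PA : P *m adjmx R (compl_graph (cycle_graph n)) =
    diag_mx (\row_j ((d j)%:C : Cplx R)) *m P.
  apply/matrixP => j l; rewrite mul_diag_mx !mxE.
  rewrite /d /ev RRe_real ?compl_cycle_eigenvalue_real// exprM.
  rewrite -compl_cycle_eigenvector//.
  rewrite [RHS](reindex _ (onW_bij _ (@enum_val_bij _))) /=.
  by apply: eq_bigr => i _; rewrite !mxE exprM.
move=> /(pgst_between_diag Pu PA)[t [gamma [gamma1 cvgP]]].
exists t, gamma; split=> // z zn1.
have [i ->] := prim_rootP w_prim zn1.
(* The exponent [i] lies in ['I_n], whereas the rows of [P] are indexed through ['Z_n]. *)
pose x : 'Z_n := inZp i.
have wx : w ^+ i = w ^+ x by rewrite /= Zp_cast ?(ltnW n_gt2)// prim_expr_mod.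
have wxu : w ^+ (x * u) != 0 by rewrite expf_neq0// (prim_root_neq0 w_prim).
rewrite wx expr_ZpD// expr_ZpN// -exprM -exprM mulrA.
(* Dividing the limit for row [x] by the entry at [u] leaves the exponent [v - u]. *)
have := cvgP (enum_rank x).
rewrite !mxE !enum_rankK => /cvgMl-/(_ (w ^+ (x * u))^-1).
rewrite /d enum_rankK; under eq_fun do rewrite mulfK//.
by [].
Qed.

(** A primitive root and its inverse share an eigenvalue, so by uniqueness of limits their [d]-th
    powers agree. *)
Lemma pgst_compl_cycle_antipodal (R : realType) (n : nat) (t : nat -> R)
    (gamma : Cplx R) (d : 'Z_n) : (2 < n)%N -> gamma != 0 -> d != 0 ->
  (forall z : Cplx R, z ^+ n = 1 ->
     cis (- (t k * complex.Re (compl_cycle_eigenvalue n z))) @[k --> \oo] -->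
       gamma * z ^+ d) ->
  n = d.*2.
Proof.
move=> n_gt2 gamma0 d0 cvg_ev; have n_gt0 : (0 < n)%N by exact: ltn_trans n_gt2.
have d_gt0 : (0 < d)%N by move: d0; rewrite -val_eqE -lt0n.
have d_ltn : (d < n)%N by rewrite -[ltnRHS](Zp_cast (ltnW n_gt2)).
have [w w_prim] := @exists_prim_root (Cplx R) n n_gt0.
have wn1 := prim_expr_order w_prim.
have wVn1 : w^-1 ^+ n = 1 by rewrite exprVn wn1 invr1.
have := cvg_ev _ wVn1; rewrite compl_cycle_eigenvalueV// => cvgV.
have wd : w^-1 ^+ d = w ^+ d.
  have C_sep := @norm_hausdorff (Cplx R) (Cplx R).
  exact: (mulfI gamma0 (cvg_unique C_sep cvgV (cvg_ev _ wn1))).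
have /eqP : w ^+ (d + d) = 1.
  by rewrite exprD -{1}wd exprVn mulVf// expf_neq0// (prim_root_neq0 w_prim).
rewrite -(prim_order_dvd w_prim) addnn => /dvdnP[k dk].
(* Since [0 < 2 * d < 2 * n], the multiple [k * n = 2 * d] has [k = 1]. *)
have : (k * n < 2 * n)%N by rewrite -dk -mul2n ltn_pmul2l.
rewrite ltn_pmul2r// => k2; case: k k2 dk => [|[|]]// _; last by rewrite mul1n.
by move/eqP; rewrite mul0n double_eq0 eqn0Ngt d_gt0.
Qed.

(** The product runs over a coset of the [p]-th roots of unity, on which [z] and [z^-1] both sum to
    zero, so only the terms [-1] of the eigenvalues survive. *)
Lemma cvg_cis_progression (R : realType) (m p a : nat) (t : nat -> R)
    (gamma w : Cplx R) (d : 'Z_(m * p)) :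
  (2 < m * p)%N -> (1 < p)%N -> (0 < a < m)%N ->
  (m * p).-primitive_root w -> (w ^+ m) ^+ d = 1 ->
  (forall z : Cplx R, z ^+ (m * p) = 1 ->
     cis (- (t k * complex.Re (compl_cycle_eigenvalue (m * p) z)))
       @[k --> \oo] --> gamma * z ^+ d) ->
  cis (- (t k * - p%:R)) @[k --> \oo] --> gamma ^+ p * (w ^+ d) ^+ (a * p).
Proof.
move=> mp_gt2 p_gt1 /andP[a0 am] w_prim zeta_d cvg_ev.
have wn1 := prim_expr_order w_prim.
pose ev (z : Cplx R) := complex.Re (compl_cycle_eigenvalue (m * p) z).
pose zeta := w ^+ m; have zetap : zeta ^+ p = 1 by rewrite -exprM.
have zeta1 : zeta != 1.
  have m_gt0 : (0 < m)%N by exact: leq_ltn_trans am.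
  by rewrite -(prim_order_dvd w_prim) gtnNdvd// -[ltnLHS]muln1 ltn_pmul2l.
pose z (k : 'I_p) := w ^+ a * zeta ^+ k.
have zn1 k : z k ^+ (m * p) = 1.
  by rewrite /z -exprM -exprD -exprM mulnC exprM wn1 expr1n.
(* As [0 < a < m], the exponent [a + m * k] is not a multiple of [m]; this avoids the exceptional
   eigenvalue at [1]. *)
have z_neq1 k : z k != 1.
  rewrite /z -exprM -exprD -(prim_order_dvd w_prim).
  apply: contraL am => /(dvdn_trans (dvdn_mulr p (dvdnn m))).
  by rewrite dvdn_addl ?dvdn_mulr// -leqNgt => /dvdn_leq->.
have sum_ev : \sum_k ev (z k) = - p%:R.
  have sumz : \sum_k z k = 0 by rewrite -mulr_sumr sum_expr_root1 ?mulr0.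
  have sumzV : \sum_k (z k)^-1 = 0.
    under eq_bigr do rewrite invfM -(exprVn zeta).
    rewrite -mulr_sumr sum_expr_root1 ?mulr0 ?exprVn ?zetap ?invr1//.
    by rewrite invr_eq1.
  have evE k : (ev (z k))%:C = - 1 - z k - (z k)^-1 :> Cplx R.
    rewrite RRe_real ?compl_cycle_eigenvalue_real//.
    by rewrite /compl_cycle_eigenvalue sum_Zp_expr// sub0r.
  apply: complexI; rewrite (raddf_sum (real_complex R)).
  rewrite (eq_bigr _ (fun k _ => evE k)).
  rewrite !sumrB sumz sumzV !subr0 sumr_const card_ord.
  by rewrite rmorphN rmorph_nat mulNrn.
(* As [zeta ^+ d = 1], all [p] limits coincide. *)
have -> : gamma ^+ p * (w ^+ d) ^+ (a * p) = \prod_k (gamma * z k ^+ d).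
  under [RHS]eq_bigr do rewrite exprMn [(zeta ^+ _) ^+ _]exprAC zeta_d expr1n mulr1.
  by rewrite prodr_const card_ord exprMn -!exprM mulnCA.
have -> : (fun k => cis (- (t k * - p%:R))) =
          (fun k => \prod_i cis (- (t k * ev (z i)))).
  by apply/funext => k; rewrite -sum_ev mulr_sumr -sumrN; exact: cis_sum.
by apply: (@cvgr_prod (Cplx R)) => i; exact: cvg_ev.
Qed.

Lemma compl_cycle_not_pgst (R : realType) (m p : nat) :
  (0 < m)%N -> m <> 2%N -> prime p -> odd p ->
  ~ pgst R (compl_graph (cycle_graph (m * p))).
Proof.
move=> m_gt0 m_neq2 p_prime p_odd [u [v [uv]]].
have p_gt2 : (2 < p)%N by rewrite odd_prime_gt2.
have mp_gt2 : (2 < m * p)%N by rewrite (leq_trans p_gt2)// leq_pmull.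
have mp_gt0 : (0 < m * p)%N by exact: ltn_trans mp_gt2.
move=> /(pgst_compl_cycle mp_gt2)[t [gamma [gamma1 cvg_ev]]].
have gamma0 : gamma != 0 by rewrite -normr_gt0 gamma1.
have vu : v - u != 0 by rewrite subr_eq0 eq_sym.
have [w w_prim] := @exists_prim_root (Cplx R) _ mp_gt0.
move: (v - u) vu cvg_ev => d d0 cvg_ev.
have mp2d := pgst_compl_cycle_antipodal mp_gt2 gamma0 d0 cvg_ev.
(* [w ^+ d] squares to [1], and [0 < d < m * p] excludes the value [1]. *)
have wdN1 : w ^+ d = -1.
  have /eqP : (w ^+ d) ^+ 2 = 1.
    by rewrite -exprM muln2 -mp2d (prim_expr_order w_prim).
  rewrite sqrf_eq1 => /orP[|/eqP//].
  rewrite -(prim_order_dvd w_prim) => /dvdn_leq; rewrite lt0n => /(_ d0).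
  by rewrite leqNgt -[ltnRHS](Zp_cast (ltnW mp_gt2)) ltn_ord.
have m_even : ~~ odd m.
  by have := odd_double d; rewrite -mp2d oddM p_odd andbT => ->.
(* This bound makes both [a = 1] and [a = 2] admissible in [0 < a < m]. *)
have m_gt2 : (2 < m)%N.
  by case: m m_gt0 m_neq2 m_even {mp_gt2 mp_gt0 w_prim u v uv d d0 cvg_ev mp2d wdN1}
    => [|[|[|]]].
have zeta_d : (w ^+ m) ^+ d = 1.
  by rewrite exprAC wdN1 -signr_odd (negPf m_even).
have cvg_prod a (am : (0 < a < m)%N) :=
  cvg_cis_progression mp_gt2 (ltnW p_gt2) am w_prim zeta_d cvg_ev.
have : (w ^+ d) ^+ (1 * p) = (w ^+ d) ^+ (2 * p).
  apply: (mulfI (expf_neq0 p gamma0)).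
  have C_sep := @norm_hausdorff (Cplx R) (Cplx R).
  exact: (cvg_unique C_sep (cvg_prod 1%N (ltnW m_gt2)) (cvg_prod 2%N m_gt2)).
(* The two sides are [-1] and [1], since [p] is odd. *)
rewrite wdN1 mul1n exprM sqrrN expr1n expr1n -signr_odd p_odd => /eqP.
by rewrite eq_sym -addr_eq0 -mulr2n pnatr_eq0.
Qed.

End Scopes.

Theorem corollary2p8 (R : realType) (m p n : nat)
    (hm0 : (0 < m)%N) (hm2 : m <> 2) (hp : prime p) (hpo : odd p)
    (hn : n = (m * p)%N) :
  ~ pgst R (compl_graph (cycle_graph n)).
Proof. by rewrite hn; exact: compl_cycle_not_pgst. Qed.
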